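(* Let $\mathbb{K}\in\{\mathbb{R},\mathbb{C}\}$, let $\Omega\neq\emptyset$ be a set, let $V_n$ be the $\mathbb{K}$-linear span of $n$ linearly independent functions $\varphi_1,\ldots,\varphi_n:\Omega\to\mathbb{K}$, and let $L:V_n\to\mathbb{K}$ be a non-trivial ($L\ne0$) $\mathbb{K}$-linear functional. The following assertions are equivalent: (i) $L$ is positively discretizable. (ii) There exists a subset $S\neq\emptyset$ of $\Omega$ such that $$\ker_{\ge0}(\operatorname{Re}\circ\Lambda_S)\subseteq\ker_{\ge0}(\operatorname{Re}\circ L)\quad\text{and}\quad \ker_{\ge0}(\operatorname{Re}\circ\Lambda_S)\cap\ker(\operatorname{Re}\circ L)\subseteq\ker(\operatorname{Re}\circ\Lambda_S).$$ If $L$ is positively discretizable, the maximal number of discretizing nodes needed is $N=\operatorname{eff-dim}_{\mathbb{R}}V_n$ (i.e., $L$ then has a positive discretization with at most $N$ nodes).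
   Context: $L$ is called positively discretizable if there exist finitely many nodes $x_1,\ldots,x_M\in\Omega$ and non-negative weights $\lambda_1,\ldots,\lambda_M\ge0$ such that $Lf=\sum_{j=1}^M\lambda_jf(x_j)$ for all $f\in V_n$. For $\emptyset\ne S\subseteq\Omega$, $\Lambda_S:V_n\to\mathbb{K}^S$, $f\mapsto f|_S$, is the restriction map, and $\operatorname{Re}$ takes pointwise real parts, so $\operatorname{Re}\circ\Lambda_S:V_n\to\mathbb{R}^S$ and $\operatorname{Re}\circ L:V_n\to\mathbb{R}$ are $\mathbb{R}$-linear. For an $\mathbb{R}$-linear map $R:V\to\mathbb{R}^I$ from a real vector space $V$, with $I$ any index set ($\mathbb{R}$ corresponding to a one-point $I$), $\ker_{\ge0}(R):=\{f\in V: Rf\ge0\}$ (componentwise inequality) and $\ker(R)=\{f\in V:Rf=0\}$. The effective real dimension is $\operatorname{eff-dim}_{\mathbb{R}}V_n:=\dim_{\mathbb{R}}\{\operatorname{Re}\circ f: f\in V_n\}$. *)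

(* Defs.v *)
From HB Require Import structures.
From mathcomp Require Import all_boot all_order all_algebra.
From mathcomp Require Import complex.
From mathcomp Require Import boolp classical_sets functions reals.

Set Implicit Arguments.
Unset Strict Implicit.
Unset Printing Implicit Defensive.

Import Order.TTheory GRing.Theory Num.Theory.

Local Open Scope classical_set_scope.
Local Open Scope ring_scope.

Section LinearAlgebra.
Variables (K : fieldType) (E : lmodType K).

Definition lin_indep (n : nat) (b : 'I_n -> E) : Prop :=
  forall c : 'I_n -> K, \sum_i c i *: b i = 0 -> forall i, c i = 0.

Definition lin_span (n : nat) (b : 'I_n -> E) : set E :=
  [set f | exists c : 'I_n -> K, f = \sum_i c i *: b i].

Definition is_basis (W : set E) (n : nat) (b : 'I_n -> E) : Prop :=
  lin_indep b /\ W = lin_span b.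

(* The default value 0 is only taken when W has no finite basis. *)
Definition dim (W : set E) : nat :=
  xget 0%N [set N | exists b : 'I_N -> E, is_basis W b].

Lemma lin_indep_le_span n m (b : 'I_n -> E) (d : 'I_m -> E) :
  lin_indep b -> (forall i, lin_span d (b i)) -> (n <= m)%N.
Proof.
move=> ib sb.
have /choice[A bA] : forall i, exists c : 'I_m -> K, b i = \sum_j c j *: d j.
  exact: sb.
pose M : 'M_(n, m) := \matrix_(i, j) A i j.
suff /eqP <- : row_free M by exact: rank_leq_col.
apply/inj_row_free => v vM0; apply/rowP => i; rewrite mxE.
apply: (ib (fun i => v 0 i)).
under eq_bigr do rewrite bA scaler_sumr.
rewrite exchange_big big1 // => j _.
under eq_bigr do rewrite scalerA.
rewrite -scaler_suml.
have /rowP/(_ j) := vM0; rewrite !mxE => e.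
rewrite [X in X *: _](_ : _ = 0) ?scale0r // -[RHS]e.
by apply: eq_bigr => l _; rewrite mxE.
Qed.

Lemma lin_span_mem n (b : 'I_n -> E) i : lin_span b (b i).
Proof.
exists (fun j => (j == i)%:R).
rewrite (bigD1 i) //= eqxx scale1r big1 ?addr0 // => j /negPf->.
by rewrite scale0r.
Qed.

Lemma dim_basis (W : set E) n (b : 'I_n -> E) : is_basis W b -> dim W = n.
Proof.
move=> [ib Wb]; apply: xget_unique; first by exists b.
move=> m [d [id Wd]]; apply/eqP; rewrite eqn_leq.
apply/andP; split.
  by apply: (lin_indep_le_span (d := b) id) => i; rewrite -Wb Wd; exact: lin_span_mem.
by apply: (lin_indep_le_span (d := d) ib) => i; rewrite -Wd Wb; exact: lin_span_mem.
Qed.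

Lemma lin_span_submod_closed n (b : 'I_n -> E) :
  submod_closed [pred f | `[< lin_span b f >]].
Proof.
split.
  apply/asboolP; exists (fun=> 0).
  by rewrite big1 // => i _; rewrite scale0r.
move=> a u v /asboolP[c ->] /asboolP[d ->]; apply/asboolP.
exists (fun i => a * c i + d i).
rewrite scaler_sumr -big_split; apply: eq_bigr => i _.
by rewrite scalerDl scalerA.
Qed.

End LinearAlgebra.

(* The linear span of b as a module in its own right, so that a functional
   on it can be a {scalar span_mod b}. *)
Section SpanModule.
Variables (K : fieldType) (E : lmodType K) (n : nat) (b : 'I_n -> E).

Definition span_pred : {pred E} := [pred f | `[< lin_span b f >]].

HB.instance Definition _ :=
  GRing.isSubmodClosed.Build K E span_pred (lin_span_submod_closed b).

Record span_mod := SpanMod { span_val :> E; _ : span_val \in span_pred }.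

HB.instance Definition _ := [isSub for span_val].
HB.instance Definition _ := [Choice of span_mod by <:].
HB.instance Definition _ := [SubChoice_isSubLmodule of span_mod by <:].

End SpanModule.

Variant scalar_kind := RealScalars | ComplexScalars.

Section Scalars.
Variables (R : realType) (k : scalar_kind).

Definition scalars : fieldType :=
  match k with
  | RealScalars => R : fieldType
  | ComplexScalars => R[i] : fieldType
  end.

Definition re : scalars -> R :=
  match k return match k with
                 | RealScalars => R : fieldType
                 | ComplexScalars => R[i] : fieldType
                 end -> R
  with
  | RealScalars => fun x => x
  | ComplexScalars => fun z => complex.Re z
  end.

Definition of_real : R -> scalars :=
  match k return R -> match k with
                      | RealScalars => R : fieldType
                      | ComplexScalars => R[i] : fieldType
                      end
  with
  | RealScalars => fun x => x
  | ComplexScalars => fun x => real_complex R x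
  end.

End Scalars.

Section Kernels.
Variables (R : realType) (V I : Type).

Definition ker_ge0 (T : V -> I -> R) : set V := [set f | forall i, 0 <= T f i].

Definition ker_eq0 (T : V -> I -> R) : set V := [set f | forall i, T f i = 0].

End Kernels.

Section Discretization.
Variables (R : realType) (k : scalar_kind).
Local Notation K := (scalars R k).
Variables (Omega : Type) (n : nat) (phi : 'I_n -> Omega -> K^o).

Definition V_ : lmodType K := span_mod phi.

Definition fun_of (f : V_) : Omega -> K := @span_val _ _ _ phi f.

Definition pos_discretizable_with (L : {scalar V_}) (M : nat) : Prop :=
  exists (x : 'I_M -> Omega) (lambda : 'I_M -> R),
    (forall j, 0 <= lambda j) /\
    forall f : V_, L f = \sum_(j < M) of_real k (lambda j) * fun_of f (x j).

Definition pos_discretizable (L : {scalar V_}) : Prop :=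
  exists M : nat, pos_discretizable_with L M.

Definition Lambda (S : set Omega) (f : V_) : S -> K := sigL S (fun_of f).

Definition Re_Lambda (S : set Omega) (f : V_) : S -> R :=
  fun x => re (Lambda f x).

Definition Re_functional (L : {scalar V_}) (f : V_) : unit -> R :=
  fun=> re (L f).

Definition eff_dim : nat :=
  dim (range (fun f : V_ => (fun x => re (fun_of f x)) : Omega -> R^o)).

End Discretization.

Arguments Lambda {R k Omega n} phi S f.
Arguments Re_Lambda {R k Omega n} phi S f.

(* Main.v *)
From HB Require Import structures.
Require Import Defs.
From mathcomp Require Import all_boot all_order all_algebra.
From mathcomp Require Import complex lra.
From mathcomp Require Import boolp classical_sets functions reals.

Import Order.TTheory GRing.Theory Num.Theory.

Local Open Scope classical_set_scope.
Local Open Scope ring_scope.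

(** Everything reduces to real parts. A functional commuting with
multiplication by scalars is determined by its real part, so L = sum_j w_j
delta_(x_j) on V_n as soon as Re L f = sum_j w_j Re f(x_j) for all f
(discretization_of_real_part), and the real vector space of the functions
Re f, or of their restrictions to a set S, has a finite basis
(real_parts_basis).

If L is discretized with positive weights at the points of S, both kernel
conditions hold for S because a sum of nonnegative terms is nonnegative, and
vanishes only if every term does.

Conversely, choose a basis b_1, ..., b_N of the functions Re f restricted to S,
with b_i = Re f_i on S. The first condition makes Re L f depend only on Re f on
S, so Re L becomes the vector l = (Re L f_i)_i, and the claim is that l is a
finite conic combination of the vectors a(x) = (b_i(x))_i, x in S. Otherwise a
nonzero g has g . a(x) >= 0 for all x in S and g . l <= 0. Then
f = sum_i g_i f_i has Re f >= 0 on S and Re L f <= 0, hence Re L f = 0 by the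
first condition and Re f = 0 on S by the second; independence of the b_i
gives g = 0, a contradiction. The cone need not be closed: weak
separation by a nonzero functional is enough, and in finite dimension it holds
for every convex cone (cone_separation).

Weak separation is obtained by enlarging the cone, with Zorn's lemma, to a
maximal one that still avoids l. Maximality makes the cone contain v or -v for
every v, so it is the nonnegative cone of a total preorder. A finite spanning
family provides an order unit e, and v |-> sup {t | t e <= v} is the required
functional.

The bound on the number of nodes is the conic form of Caratheodory's theorem
(conic_caratheodory): more than N point evaluations on an N-dimensional
space are linearly dependent, and subtracting a suitable multiple of a
dependency cancels one weight and keeps the others nonnegative. *)

(** * Separation of a point from a convex cone *)

Section Cones.
Context {R : realType} {V : lmodType R}.
Implicit Types (A C : set V) (u v l e : V) (s t : R).

Definition convex_cone C : Prop :=
  (forall u v, C u -> C v -> C (u + v)) /\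
  (forall t v, 0 <= t -> C v -> C (t *: v)).

Definition total_cone C : Prop := convex_cone C /\ forall v, C v \/ C (- v).

Lemma cone_sum C (I : finType) (F : I -> V) :
  convex_cone C -> C 0 -> (forall i, C (F i)) -> C (\sum_i F i).
Proof. by move=> [CD _] C0 CF; elim/big_ind: _. Qed.

(** A maximal convex cone A that contains C and avoids l is total: if neither
x nor -x lies in A, maximality puts l both in A + R_+ x and in A - R_+ x, and a
positive combination of the two expressions of l cancels x. *)
Lemma total_cone_avoiding C l : convex_cone C -> C 0 -> ~ C l ->
  exists A, [/\ total_cone A, C `<=` A & ~ A l].
Proof.
move=> cC C0 Cl.
(* Stability under addition of C stands for C `<=` A: it also holds for the
   empty set, the union of the empty chain. *)
pose P := [set A : set V | [/\ convex_cone A,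
  forall a c, A a -> C c -> A (a + c) & ~ A l]].
have [F FP Ftot|A [[[AD AZ] AC Al] Amax]] := @Zorn_bigcup V P.
  split; last by move=> [X FX Xl]; have [_ _] := FP _ FX; exact.
    split=> [u v [X FX Xu] [Y FY Yv]|t v t0 [X FX Xv]]; last first.
      by exists X => //; have [[_ XZ] _ _] := FP _ FX; exact: XZ.
    have [XY|YX] := Ftot _ _ FX FY.
      by exists Y => //; have [[YD _] _ _] := FP _ FY; apply: YD => //; exact: XY.
    by exists X => //; have [[XD _] _ _] := FP _ FX; apply: XD => //; exact: YX.
  move=> a c [X FX Xa] Cc; exists X => //.
  by have [_ XC _] := FP _ FX; exact: XC.
have [a Aa] : A !=set0.
  apply/set0P/negP => /eqP A0; apply: (Amax C).
    by rewrite A0; split=> // /(_ 0 C0).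
  by split=> // a c; apply cC.1.
have A0 : A 0 by rewrite -(scale0r a); exact: AZ.
have CA : C `<=` A by move=> c Cc; rewrite -(add0r c); exact: AC.
have extend x : ~ A x -> exists b t, [/\ A b, 0 <= t & l = b + t *: x].
  move=> Ax; apply: contrapT => nl.
  apply: (Amax [set y | exists b t, [/\ A b, 0 <= t & y = b + t *: x]]).
    split; last first.
      move=> /(_ x); apply: contra_not Ax; apply.
      by exists 0, 1; split=> //; rewrite add0r scale1r.
    by move=> y Ay; exists y, 0; split; rewrite // scale0r addr0.
  split=> //.
  - split=> [_ _ [b [t [Ab t0 ->]]] [b' [t' [Ab' t0' ->]]]|s _ s0 [b [t [Ab t0 ->]]]].
      exists (b + b'), (t + t'); split; [exact: AD|exact: addr_ge0|].
      by rewrite scalerDl addrACA.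
    exists (s *: b), (s * t); split; [exact: AZ|exact: mulr_ge0|].
    by rewrite scalerDr scalerA.
  - move=> _ c [b [t [Ab t0 ->]]] Cc; exists (b + c), t; split=> //; first exact: AC.
    by rewrite addrAC.
exists A; split=> //; split=> // x; apply: contrapT => /not_orP[Ax Anx].
have [b [t [Ab t0 lE]]] := extend _ Ax.
have [b' [t' [Ab' t0' lE']]] := extend _ Anx.
have [t00|t_neq0] := eqVneq t 0.
  by apply: Al; rewrite lE t00 scale0r addr0.
have tp : 0 < t by rewrite lt_neqAle eq_sym t_neq0.
apply: Al; rewrite -[l]scale1r -(@mulVf _ (t + t')) ?gt_eqF ?ltr_wpDr//.
rewrite -scalerA; apply: (AZ); first by rewrite invr_ge0 addr_ge0.
(* The weights t' and t on the two expressions cancel the multiples of x. *)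
rewrite scalerDl {1}lE' lE !scalerDr !scalerN !scalerA (mulrC t' t).
by rewrite addrACA addNr addr0; apply: (AD); exact: AZ.
Qed.

(** The sum of the |b_i|, where |v| is whichever of v and -v lies in A,
dominates every b_i and every -b_i, hence every v up to a factor. Its opposite
cannot lie in A, since otherwise A would be the whole space. *)
Lemma order_unit_of_span r (b : 'I_r -> V) A l : lin_span b = setT ->
  total_cone A -> ~ A l ->
  exists2 e, ~ A (- e) & forall v, exists2 t, 0 <= t & A (t *: e - v).
Proof.
move=> bT [[AD AZ] Atot] Al.
have A0 : A 0 by have [] := Atot 0; rewrite ?oppr0.
have /choice[s sP] : forall i, exists s : R, [/\ A (s *: b i),
    A (s *: b i - b i) & A (s *: b i + b i)].
  move=> i; have [Ab|Ab] := Atot (b i).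
    exists 1; rewrite scale1r subrr; split=> //; exact: AD.
  exists (-1); rewrite scaleN1r addNr; split=> //; exact: AD.
pose e := \sum_i s i *: b i.
have eA i : A (e - b i) /\ A (e + b i).
  have [_ m p] := sP i.
  by rewrite /e (bigD1 i)//=; split; rewrite addrAC; apply: (AD) => //;
    elim/big_ind: _ => // j _; have [] := sP j.
have unit v : exists2 t, 0 <= t & A (t *: e - v).
  have : lin_span b v by rewrite bT.
  move=> [c ->]; exists (\sum_i `|c i|); first exact: sumr_ge0.
  rewrite scaler_suml -sumrB; apply: cone_sum => // i.
  have [ci|/ltW ci] := leP 0 (c i).
    by rewrite ger0_norm// -scalerBr; apply: (AZ) => //; have [] := eA i.
  rewrite ler0_norm// scaleNr -opprD -scalerDr -scaleNr.
  by apply: (AZ); rewrite ?oppr_ge0//; have [] := eA i.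
exists e => // Ane; apply: Al.
have [t t0] := unit (- l); rewrite opprK => Atl.
by rewrite -(addrK (t *: e) l) addrC (addrC l) -scalerN addrC; apply: (AD) => //; exact: AZ.
Qed.

(** For the preorder whose nonnegative cone is A, put
g v = sup {t | t e <= v}. Totality turns this into a cut: t e <= v for t < g v
and v <= t e for t > g v. A number is determined by this property, which sums
and multiples satisfy as well, whence linearity. *)
Lemma functional_of_total_cone A e : total_cone A -> ~ A (- e) ->
  (forall v, exists2 t, 0 <= t & A (t *: e - v)) ->
  exists2 g : {scalar V}, g e = 1 & forall v, A v -> 0 <= g v.
Proof.
move=> [[AD AZ] Atot] Ane unit.
have Ae : A e by case: (Atot e).
have A0 : A 0 by rewrite -(scale0r e); exact: AZ.
(* No v lies above s e and below t e with t < s, since -e is not in A. *)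
have cut s t v : A (v - s *: e) -> A (t *: e - v) -> s <= t.
  move=> As At; rewrite leNgt; apply/negP => ts; apply: Ane.
  have -> : - e = (s - t)^-1 *: ((v - s *: e) + (t *: e - v)).
    rewrite [X in _ *: X]addrC addrA subrK -scalerBl -[t - s]opprB scalerA mulrN mulVf ?scaleN1r//.
    by rewrite subr_eq0 gt_eqF.
  by apply: (AZ); [rewrite invr_ge0 subr_ge0 ltW|exact: AD].
pose T v := [set t | A (v - t *: e)].
have supT v : has_sup (T v).
  split.
    have [t _ At] := unit (- v); exists (- t).
    by rewrite /T /= scaleNr opprK addrC -(opprK v).
  have [t _ At] := unit v; exists t => s Ts; exact: cut At.
pose g v := sup (T v).
have g_below s v : s < g v -> A (v - s *: e).
  move=> /(sup_gt (supT v).1) [t Tt /ltW st].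
  rewrite -(subrK (t *: e) v) -addrA -scalerBl.
  by apply: (AD) => //; apply: (AZ); rewrite ?subr_ge0.
have g_above s v : g v < s -> A (s *: e - v).
  move=> gs; have [|] := Atot (v - s *: e); last by rewrite opprB.
  by move/(ub_le_sup (supT v).2); rewrite leNgt gs.
have gE v t : (forall s, s < t -> A (v - s *: e)) ->
    (forall s, t < s -> A (s *: e - v)) -> g v = t.
  move=> lo hi; apply/eqP; rewrite eq_le; apply/andP; split; rewrite leNgt; apply/negP.
    move=> tg; have : t < (t + g v) / 2 < g v by apply/andP; split; lra.
    move=> /andP[/hi h1 h2]; have := cut _ _ _ (g_below ((3 * g v + t) / 4) _ _) h1.
    by lra.
  move=> tg; have : g v < (t + g v) / 2 < t by apply/andP; split; lra.
  move=> /andP[h2 /lo h1]; have := cut _ _ _ h1 (g_above ((3 * g v + t) / 4) _ _).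
  by lra.
have gD u v : g (u + v) = g u + g v.
  apply: gE => s hs.
    pose d := (g u + g v - s) / 2.
    have -> : u + v - s *: e = (u - (g u - d) *: e) + (v - (g v - d) *: e).
      rewrite addrACA -opprD -scalerDl; congr (_ - _ *: _); rewrite /d; lra.
    by apply: (AD); apply: g_below; rewrite /d; lra.
  pose d := (s - g u - g v) / 2.
  have -> : s *: e - (u + v) = ((g u + d) *: e - u) + ((g v + d) *: e - v).
    rewrite addrACA -opprD -scalerDl; congr (_ *: _ - _); rewrite /d; lra.
  by apply: (AD); apply: g_above; rewrite /d; lra.
have gN v : g (- v) = - g v.
  apply: gE => s hs.
    by rewrite addrC -scaleNr; apply: g_above; rewrite ltrNr.
  by rewrite opprK addrC -(opprK s) scaleNr; apply: g_below; rewrite ltrNl.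
have gZp a v : 0 < a -> g (a *: v) = a * g v.
  move=> a0; apply: gE => s hs.
    rewrite -(divfK (lt0r_neq0 a0) s) mulrC -scalerA -scalerBr.
    by apply: (AZ); [exact: ltW|apply: g_below; rewrite ltr_pdivrMr// mulrC].
  rewrite -(divfK (lt0r_neq0 a0) s) mulrC -scalerA -scalerBr.
  by apply: (AZ); [exact: ltW|apply: g_above; rewrite ltr_pdivlMr// mulrC].
have gZ a v : g (a *: v) = a * g v.
  have [a0|a0|->] := ltgtP a 0; last first.
  - rewrite scale0r mul0r; apply: (@addrI _ (g 0)).
    by rewrite -gD !addr0.
  - exact: gZp.
  by rewrite -{1}(opprK a) scaleNr gN gZp ?oppr_gt0// mulNr opprK.
have gL : scalar g by move=> a u v; rewrite gD gZ.
pose G : {scalar V} := HB.pack g (GRing.isLinear.Build _ _ _ _ g gL).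
exists G.
  apply: gE => s hs.
    rewrite -[X in A (X - _)]scale1r -scalerBl.
    by apply: (AZ) => //; rewrite subr_ge0 ltW.
  rewrite -[X in A (_ - X)]scale1r -scalerBl.
  by apply: (AZ) => //; rewrite subr_ge0 ltW.
by move=> v Av; apply: ub_le_sup; [exact: (supT v).2|rewrite /T/= scale0r subr0].
Qed.

(** The cone C need not be closed, so that l may lie on its boundary: hence g is
only required to be nonzero, and g l <= 0 to hold without strictness. *)
Lemma cone_separation r (b : 'I_r -> V) C l : lin_span b = setT ->
  convex_cone C -> C 0 -> ~ C l ->
  exists g : {scalar V}, [/\ exists v, g v != 0,
    forall v, C v -> 0 <= g v & g l <= 0].
Proof.
move=> bT cC C0 Cl.
have [A [tA CA Al]] := total_cone_avoiding _ _ cC C0 Cl.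
have [e Ane unit] := order_unit_of_span _ _ _ _ bT tA Al.
have [g ge gA] := functional_of_total_cone _ _ tA Ane unit.
have ANl : A (- l) by case: tA => _ /(_ l) [].
exists g; split=> //.
- by exists e; rewrite ge oner_neq0.
- by move=> v /CA /gA.
by have := gA _ ANl; rewrite linearN oppr_ge0.
Qed.

End Cones.

(** * Finite bases and conic combinations *)

(** A dependent family keeps its span when one of the vectors occurring in a
dependency is dropped. *)
Lemma span_has_basis {K : fieldType} {E : lmodType K} n (d : 'I_n -> E) :
  exists m (b : 'I_m -> E), is_basis (lin_span d) b.
Proof.
elim: n d => [|n IH] d; first by exists 0%N, d; split=> // c _ [].
have [di|] := pselect (lin_indep d); first by exists n.+1, d.
move=> /existsNP[c] /not_implyP[c0 /existsNP[i /eqP ci]].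
have [m [b [bi bd]]] := IH (d \o lift i).
exists m, b; split=> //; rewrite -bd; apply/seteqP; split=> _ [a ->].
  have di : d i = \sum_j (- (c i)^-1 * c (lift i j)) *: d (lift i j).
    apply: (scalerI ci); rewrite scaler_sumr.
    move/eqP: c0; rewrite (bigD1_ord i)//= addr_eq0 => /eqP ->.
    rewrite -sumrN; apply: eq_bigr => j _.
    by rewrite scalerA mulrA mulrN mulfV// mulN1r scaleNr.
  exists (fun j => a i * (- (c i)^-1 * c (lift i j)) + a (lift i j)).
  rewrite (bigD1_ord i)//= di scaler_sumr -big_split/=.
  by apply: eq_bigr => j _; rewrite scalerDl scalerA.
exists (fun k => if unlift i k is Some j then a j else 0).
rewrite (bigD1_ord i)//= unlift_none scale0r add0r.
by apply: eq_bigr => j _; rewrite liftK.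
Qed.

Section ConicHull.
Context {R : realType}.

(** Lists of weighted indices make addition of combinations a concatenation. *)
Definition conic_hull {V : lmodType R} {T : Type} (a : T -> V) : set V :=
  [set v | exists2 s : seq (R * T), all (fun p => 0 <= p.1) s &
             v = \sum_(p <- s) p.1 *: a p.2].

Lemma conic_hull_convex {V : lmodType R} {T : Type} (a : T -> V) :
  convex_cone (conic_hull a).
Proof.
split=> [_ _ [s sp ->] [s' sp' ->]|t _ t0 [s sp ->]].
  by exists (s ++ s'); rewrite ?all_cat ?sp ?sp'// big_cat.
exists [seq (t * p.1, p.2) | p <- s].
  rewrite all_map; apply: sub_all sp => p /=; exact: mulr_ge0.
by rewrite scaler_sumr big_map; apply: eq_bigr => p _; rewrite scalerA.
Qed.

Lemma conic_hullP {V : lmodType R} {T : Type} (a : T -> V) v :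
  conic_hull a v -> exists M (x : 'I_M -> T) (w : 'I_M -> R),
    (forall j, 0 <= w j) /\ v = \sum_j w j *: a (x j).
Proof.
move=> [s sp ->].
exists (size s), (fun j => (tnth (in_tuple s) j).2), (fun j => (tnth (in_tuple s) j).1).
split=> [j|]; last by rewrite big_tnth.
exact: (all_tnthP (t := in_tuple s) sp).
Qed.

(** In coordinates the separating functional becomes a list of coefficients, with
which a combination of functions can be formed. *)
Lemma conic_hull_separation {T : Type} r (a : T -> 'rV[R]_r) (l : 'rV[R]_r) :
  ~ conic_hull a l -> exists g : 'I_r -> R, [/\ exists i, g i != 0,
    forall x, 0 <= \sum_i g i * a x 0 i & \sum_i g i * l 0 i <= 0].
Proof.
move=> nl.
have C0 : conic_hull a 0 by exists [::]; rewrite ?big_nil.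
have span : lin_span (fun i : 'I_r => delta_mx 0 i : 'rV[R]_r) = setT.
  by apply/seteqP; split=> // v _; exists (v 0); exact: row_sum_delta.
have [g [[v gv] ga gl]] :=
  cone_separation _ _ _ _ span (conic_hull_convex a) C0 nl.
have gE w : g w = \sum_i g (delta_mx 0 i) * w 0 i.
  rewrite {1}(row_sum_delta w) linear_sum; apply: eq_bigr => i _.
  by rewrite linearZ mulrC.
exists (fun i => g (delta_mx 0 i)); split; last by rewrite -gE.
  apply: contrapT => /forallNP g0; move/eqP: gv; apply.
  by rewrite gE big1// => i _; move/negP: (g0 i); rewrite negbK => /eqP ->; rewrite mul0r.
move=> x; rewrite -gE; apply: ga; exists [:: (1, x)]; rewrite ?big_seq1 ?scale1r//=.
by rewrite ler01.
Qed.

(** A dependency c among the a_j with some c_i > 0 can be subtracted from the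
weights, scaled so that the first weight to reach 0 does so exactly. *)
Lemma conic_caratheodory N M (a : 'I_M.+1 -> 'rV[R]_N) (w : 'I_M.+1 -> R) :
  (N <= M)%N -> (forall j, 0 <= w j) ->
  exists (i : 'I_M.+1) (w' : 'I_M -> R), (forall j, 0 <= w' j) /\
    \sum_j w j *: a j = \sum_j w' j *: a (lift i j).
Proof.
move=> NM w0.
have [c c_dep [i ci]] : exists2 c : 'I_M.+1 -> R,
    \sum_j c j *: a j = 0 & exists i, 0 < c i.
  pose A := \matrix_j a j.
  have : kermx A != 0.
    by rewrite kermx_eq0 /row_free neq_ltn ltnS (leq_trans (rank_leq_col A)).
  case/rowV0Pn => v /sub_kermxP vA /rV0Pn[i vi].
  have vA' : \sum_j v 0 j *: a j = 0.
    rewrite -[RHS]vA mulmx_sum_row; apply: eq_bigr => j _.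
    by rewrite rowK.
  have [vp|vn|v0] := ltgtP (v 0 i) 0; last by rewrite v0 eqxx in vi.
    exists (fun j => - v 0 j); last by exists i; rewrite oppr_gt0.
    by under eq_bigr do rewrite scaleNr; rewrite sumrN vA' oppr0.
  by exists (v 0) => //; exists i.
pose q j := w j / c j.
have [m cm mmin] := @arg_minP _ _ _ i (fun j => 0 < c j) q ci.
(* q m is the largest multiple of c that keeps all weights nonnegative. *)
pose w' j := w j - q m * c j.
have w'0 j : 0 <= w' j.
  rewrite subr_ge0; have [cj|cj] := ltP 0 (c j).
    by rewrite -ler_pdivlMr//; exact: mmin.
  by apply: le_trans (w0 j); rewrite mulr_ge0_le0// divr_ge0// ltW.
exists m, (w' \o lift m); split=> [j|]; first exact: w'0.
have -> : \sum_j w j *: a j = \sum_j w' j *: a j.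
  under [RHS]eq_bigr do rewrite scalerBl -scalerA.
  by rewrite sumrB -scaler_sumr c_dep scaler0 subr0.
by rewrite (bigD1_ord m)//= /w' divfK ?gt_eqF// subrr scale0r add0r.
Qed.
End ConicHull.

(** * Real parts *)

Section ScalarParts.
Context {R : realType} {k : scalar_kind}.
Local Notation K := (scalars R k).

Lemma reD (z z' : K) : re (z + z') = re z + re z'.
Proof. by rewrite /re /scalars in z z' *; case: k z z' => // -[? ?] [? ?]. Qed.

Lemma re0 : re (0 : K) = 0.
Proof. by rewrite /re; case: k. Qed.

Lemma reB (z z' : K) : re (z - z') = re z - re z'.
Proof. by apply/eqP; rewrite eq_sym subr_eq -reD subrK. Qed.

Lemma re_sum (I : finType) (F : I -> K) : re (\sum_i F i) = \sum_i re (F i).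
Proof. exact: (big_morph _ reD re0). Qed.

Lemma reM_of_real (t : R) (z : K) : re (of_real k t * z) = t * re z.
Proof.
rewrite /re /of_real /scalars in z *; case: k z => // -[x y] /=.
by rewrite mul0r subr0.
Qed.

Lemma re_mul_eq0 (z : K) : (forall u, re (u * z) = 0) -> z = 0.
Proof.
rewrite /re /scalars in z *; case: k z => [z /(_ 1)|z h]; first by rewrite mul1r.
have := h 1; have := h 'i%C; case: z {h} => x y /=.
by rewrite !mul0r !mul1r !sub0r subr0 => /eqP; rewrite oppr_eq0 => /eqP -> ->.
Qed.

(** Every scalar is a real combination of 1 and a single w, which is i for
complex scalars and can be taken to be 0 for real ones; this lets both cases
be treated at once. *)
Lemma scalars_over_reals : exists (w : K) (im : K -> R),
  forall z, z = of_real k (re z) + of_real k (im z) * w.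
Proof.
rewrite /re /of_real /scalars; case: k.
  by exists 0, (fun=> 0) => z; rewrite mulr0 addr0.
by exists 'i%C, (@complex.Im R) => z; rewrite mulrC -complexE.
Qed.

End ScalarParts.

Section RealStructure.
Context {R : realType} {k : scalar_kind} {Omega : Type} {n : nat}.
Context {phi : 'I_n -> Omega -> (scalars R k)^o}.
Local Notation K := (scalars R k).
Local Notation V := (V_ phi).

Lemma fun_of_sum (I : finType) (c : I -> K) (F : I -> V) x :
  fun_of (\sum_i c i *: F i) x = \sum_i c i * fun_of (F i) x.
Proof.
apply: (big_ind2 (fun (f : V) z => fun_of f x = z)) => // f _ g _ <- <-.
by [].
Qed.

Lemma re_functional_sum (L : {scalar V}) (I : finType) (c : I -> R) (F : I -> V) :
  re (L (\sum_i of_real k (c i) *: F i)) = \sum_i c i * re (L (F i)).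
Proof.
by rewrite linear_sum re_sum; apply: eq_bigr => i _; rewrite linearZ reM_of_real.
Qed.

Lemma re_fun_of_sum (I : finType) (c : I -> R) (F : I -> V) x :
  re (fun_of (\sum_i of_real k (c i) *: F i) x) =
  \sum_i c i * re (fun_of (F i) x).
Proof.
by rewrite fun_of_sum re_sum; apply: eq_bigr => i _; rewrite reM_of_real.
Qed.

(** The phi_j and the w phi_j generate V_n over the reals. *)
Lemma real_generators : exists m (F : 'I_m -> V), forall f : V,
  exists c : 'I_m -> R, f = \sum_i of_real k (c i) *: F i.
Proof.
have [w [im wE]] := @scalars_over_reals R k.
have phiV i : phi i \in span_pred phi by apply/asboolP; exact: lin_span_mem.
pose P i : V := SpanMod (phiV i).
exists (n + n)%N, (fun i => match fintype.split i with inl j => P j | inr j => w *: P j end).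
move=> f; have /asboolP[c fc] : span_val f \in span_pred phi by case: f.
exists (fun i => match fintype.split i with inl j => re (c j) | inr j => im (c j) end).
rewrite big_split_ord/=.
under eq_bigr do rewrite (unsplitK (inl _)).
under [X in _ + X]eq_bigr do rewrite (unsplitK (inr _)) scalerA.
rewrite -big_split/=; under eq_bigr do rewrite -scalerDl -wE.
apply: val_inj; rewrite /= fc; apply/funext => x.
by rewrite -/(fun_of _ x) fun_of_sum fct_sumE.
Qed.

(** The map h is the identity of Omega for the effective dimension, and the
inclusion of S for the restriction to S. *)
Lemma real_parts_basis (T : Type) (h : T -> Omega) :
  exists N (b : 'I_N -> T -> R^o) (F : 'I_N -> V),
    is_basis (range (fun f : V => (fun t => re (fun_of f (h t))) : T -> R^o)) b /\
    forall i t, b i t = re (fun_of (F i) (h t)).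
Proof.
have [m [G GV]] := real_generators.
pose rh (f : V) : T -> R^o := fun t => re (fun_of f (h t)).
have rhE c : rh (\sum_i of_real k (c i) *: G i) = \sum_i c i *: rh (G i).
  by apply/funext => t; rewrite fct_sumE /rh re_fun_of_sum.
have -> : range rh = lin_span (fun i => rh (G i)).
  apply/seteqP; split=> [_ [f _ <-]|_ [c ->]].
    by have [c ->] := GV f; exists c.
  by exists (\sum_i of_real k (c i) *: G i).
have [N [b bB]] := span_has_basis _ (fun i => rh (G i)).
have /choice[F FE] : forall i, exists f : V, b i = rh f.
  move=> i; have := lin_span_mem b i; rewrite -bB.2 => -[c ->].
  by exists (\sum_i of_real k (c i) *: G i).
by exists N, b, F; split=> // i t; rewrite FE.
Qed.

(** If D is the difference of the two sides, Re (u D f) = Re (D (u f)) = 0 for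
every scalar u, which forces D f = 0. *)
Lemma discretization_of_real_part (L : {scalar V}) M (x : 'I_M -> Omega) (w : 'I_M -> R) :
  (forall f, re (L f) = \sum_j w j * re (fun_of f (x j))) ->
  forall f, L f = \sum_j of_real k (w j) * fun_of f (x j).
Proof.
move=> reL f; apply/eqP; rewrite -subr_eq0; apply/eqP/re_mul_eq0 => u.
rewrite mulrBr reB; apply/eqP; rewrite subr_eq0; apply/eqP.
have <- : L (u *: f) = u * L f by rewrite linearZ.
rewrite reL mulr_sumr re_sum; apply: eq_bigr => j _.
by rewrite mulrCA reM_of_real.
Qed.

End RealStructure.

(** * Positive discretization *)

Section Equivalence.
Context {R : realType} {k : scalar_kind} {Omega : Type} {n : nat}.
Context {phi : 'I_n -> Omega -> (scalars R k)^o}.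
Local Notation V := (V_ phi).
Implicit Type L : {scalar V}.

Lemma re_discretization L M (x : 'I_M -> Omega) (w : 'I_M -> R) :
  (forall f, L f = \sum_j of_real k (w j) * fun_of f (x j)) ->
  forall f, re (L f) = \sum_j w j * re (fun_of f (x j)).
Proof.
by move=> LE f; rewrite LE re_sum; apply: eq_bigr => j _; rewrite reM_of_real.
Qed.

(** As long as there are more nodes than the dimension of the space of real
parts, the point evaluations on it are dependent and one node can be removed. *)
Lemma pos_discretizable_eff_dim L M : pos_discretizable_with L M ->
  exists M', (M' <= eff_dim phi)%N /\ pos_discretizable_with L M'.
Proof.
have [N [b [F [bB bF]]]] := real_parts_basis _ (fun x : Omega => x) (phi := phi).
have -> : eff_dim phi = N by exact: (dim_basis bB).
elim: M => [|M IH] LM; first by exists 0%N.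
have [MN|] := leqP M.+1 N; first by exists M.+1.
rewrite ltnS => NM; apply: IH.
have [x [w [w0 /re_discretization LE]]] := LM.
pose a j : 'rV[R]_N := \row_i b i (x j).
have [i0 [w' [w'0 ww']]] := conic_caratheodory _ _ a w NM w0.
exists (x \o lift i0), w'; split=> //; apply: discretization_of_real_part => f.
have : lin_span b (fun y => re (fun_of f y)) by rewrite -bB.2; exists f.
move=> [c fc].
have fE y : re (fun_of f y) = \sum_i c i * b i y.
  by have /(congr1 (@^~ y)) := fc; rewrite fct_sumE.
have sumE m (v : 'I_m -> R) (y : 'I_m -> Omega) :
    \sum_j v j * re (fun_of f (y j)) =
    \sum_i c i * (\sum_j v j *: \row_i b i (y j)) 0 i.
  under eq_bigr do rewrite fE mulr_sumr.
  rewrite exchange_big; apply: eq_bigr => i _.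
  rewrite summxE mulr_sumr; apply: eq_bigr => j _.
  by rewrite !mxE mulrCA.
by rewrite LE !sumE ww'.
Qed.

(** S consists of the nodes of nonzero weight: a node of weight 0 gives no
control over the values there. *)
Lemma kernel_conditions_of_pos_discretizable L : (exists f, L f != 0) ->
  pos_discretizable L ->
  exists S : set Omega,
     [/\ S !=set0,
         ker_ge0 (Re_Lambda phi S) `<=` ker_ge0 (Re_functional L)
       & ker_ge0 (Re_Lambda phi S) `&` ker_eq0 (Re_functional L)
           `<=` ker_eq0 (Re_Lambda phi S)].
Proof.
move=> [f0 Lf0] [M [x [w [w0 LE]]]].
have reL := re_discretization _ _ _ _ LE.
pose S := [set y | exists2 j, y = x j & w j != 0].
have term_ge0 f : ker_ge0 (Re_Lambda phi S) f ->
    forall j, true -> 0 <= w j * re (fun_of f (x j)).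
  move=> fS j _; have [->|wj] := eqVneq (w j) 0; first by rewrite mul0r.
  have Sj : x j \in S by apply/mem_set; exists j.
  by apply: mulr_ge0 => //; exact: (fS (SigSub Sj)).
exists S; split.
- apply: contrapT => /forallNP S0; move/eqP: Lf0; apply; rewrite LE.
  apply: big1 => j _; have [->|wj] := eqVneq (w j) 0.
    by rewrite (_ : of_real k 0 = 0) ?mul0r//; rewrite /of_real; case: (k).
  by have := S0 (x j); case; exists j.
- by move=> f fS ?; rewrite /Re_functional reL; apply: sumr_ge0; exact: term_ge0.
move=> f [fS /(_ tt)]; rewrite /Re_functional reL => s0 [y Sy].
have [j yj wj] := set_mem Sy.
have /eqP : w j * re (fun_of f (x j)) = 0.
  exact: (psumr_eq0P (term_ge0 f fS) (s0 : \sum_i w i * re (fun_of f (x i)) = 0)).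
rewrite mulf_eq0 (negbTE wj)/= -yj => /eqP; exact.
Qed.

(** A functional separating l from the cone of point evaluations is itself
an element f of V_n, and it would violate the kernel conditions. *)
Lemma pos_discretizable_of_kernel_conditions L (S : set Omega) :
  ker_ge0 (Re_Lambda phi S) `<=` ker_ge0 (Re_functional L) ->
  ker_ge0 (Re_Lambda phi S) `&` ker_eq0 (Re_functional L)
           `<=` ker_eq0 (Re_Lambda phi S) -> pos_discretizable L.
Proof.
move=> posL strictL.
have [N [b [F [bB bF]]]] := real_parts_basis _ (fun x : S => set_val x) (phi := phi).
pose a (x : S) : 'rV[R]_N := \row_i b i x.
pose l : 'rV[R]_N := \row_i re (L (F i)).
have reL_ge0 f : ker_ge0 (Re_Lambda phi S) f -> 0 <= re (L f).
  by move=> fS; exact: (posL f fS tt).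
(* Apply positivity to f and to -f. *)
have vanish f : (forall x : S, re (fun_of f (set_val x)) = 0) -> re (L f) = 0.
  move=> f0; apply/eqP; rewrite eq_le; apply/andP; split.
    have -> : re (L f) = - re (L (- f)).
      by rewrite linearN -[- L f]sub0r reB re0 sub0r opprK.
    rewrite oppr_le0; apply: reL_ge0 => x.
    have -> : Re_Lambda phi S (- f) x = re (0 - fun_of f (set_val x)).
      by rewrite sub0r.
    by rewrite reB re0 f0 subrr.
  by apply: reL_ge0 => x; rewrite [X in _ <= X]f0.
have [hull|nhull] := pselect (conic_hull a l); last first.
  have [g [[i gi] ga gl]] := conic_hull_separation _ _ _ nhull.
  pose f : V := \sum_i of_real k (g i) *: F i.
  have fE x : re (fun_of f (set_val x)) = \sum_i g i * b i x.
    by rewrite re_fun_of_sum; apply: eq_bigr => j _; rewrite bF.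
  have f_ge0 : ker_ge0 (Re_Lambda phi S) f.
    move=> x; have := ga x; under eq_bigr do rewrite mxE.
    by rewrite -fE.
  have Lf0 : ker_eq0 (Re_functional L) f.
    move=> u; apply/eqP; rewrite eq_le /Re_functional reL_ge0// andbT.
    rewrite re_functional_sum (le_trans _ gl)//.
    by apply: ler_sum => j _; rewrite mxE.
  have f0 : forall x : S, re (fun_of f (set_val x)) = 0 by exact: strictL.
  have g0 : \sum_i g i *: b i = 0.
    by apply/funext => x; rewrite fct_sumE -[RHS](f0 x) fE.
  by move/eqP: gi; have := bB.1 _ g0 i.
have [M [x [w [w0 lE]]]] := conic_hullP _ _ hull.
exists M, (fun j => set_val (x j)), w; split=> //.
apply: discretization_of_real_part => f.
have : lin_span b (fun y => re (fun_of f (set_val y))) by rewrite -bB.2; exists f.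
move=> [c fc].
have fE y : re (fun_of f (set_val y)) = \sum_i c i * b i y.
  by have /(congr1 (@^~ y)) := fc; rewrite fct_sumE.
have -> : re (L f) = \sum_i c i * l 0 i.
  have Lg : re (L (\sum_i of_real k (c i) *: F i)) = \sum_i c i * l 0 i.
    by rewrite re_functional_sum; apply: eq_bigr => i _; rewrite mxE.
  rewrite -Lg; apply/eqP; rewrite -subr_eq0 -reB -linearB; apply/eqP/vanish => y.
  have -> : fun_of (f - \sum_i of_real k (c i) *: F i) (set_val y) =
    fun_of f (set_val y) - fun_of (\sum_i of_real k (c i) *: F i) (set_val y) by [].
  rewrite reB fE re_fun_of_sum.
  by under [X in _ - X]eq_bigr do rewrite -bF; rewrite subrr.
under [RHS]eq_bigr do rewrite fE mulr_sumr.
rewrite exchange_big; apply: eq_bigr => i _.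
rewrite lE summxE mulr_sumr; apply: eq_bigr => j _.
by rewrite !mxE mulrCA.
Qed.

End Equivalence.

Theorem theorem3p16 (R : realType) (k : scalar_kind) (Omega : Type)
    (hOmega : inhabited Omega) (n : nat) (phi : 'I_n -> Omega -> (scalars R k)^o)
    (hphi : lin_indep phi) (L : {scalar V_ phi}) (hL : exists f, L f != 0) :
  (pos_discretizable L <->
   exists S : set Omega,
     [/\ S !=set0,
         ker_ge0 (Re_Lambda phi S) `<=` ker_ge0 (Re_functional L)
       & ker_ge0 (Re_Lambda phi S) `&` ker_eq0 (Re_functional L)
           `<=` ker_eq0 (Re_Lambda phi S)]) /\
  (pos_discretizable L ->
   exists M : nat, (M <= eff_dim phi)%N /\ pos_discretizable_with L M).
Proof.
split; last by move=> [M /pos_discretizable_eff_dim].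
split=> [|[S [_ posL strictL]]]; first exact: kernel_conditions_of_pos_discretizable.
exact: pos_discretizable_of_kernel_conditions posL strictL.
Qed.
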